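(* Let $n\in\mathbb N_0$ and assume that the $2dq\times2dq$ determinant in the denominator below is nonzero. Then for every $b\in\{1,\dots,q\}$ and every nonzero $z$ with $W_b(z)\neq0$, $$\frac{1}{\tilde N_{C,n}}\hat B_n^{(b)}(z)=\frac{1}{W_b(z)}\; \frac{\begin{vmatrix} B_n^{(1)}(z_{1,1})&\cdots&B_n^{(q)}(z_{q,2d})&B_n^{(b)}(z)\\ \vdots&&\vdots&\vdots\\ B_{n+2dq-1}^{(1)}(z_{1,1})&\cdots&B_{n+2dq-1}^{(q)}(z_{q,2d})&B_{n+2dq-1}^{(b)}(z)\\ B_{n+2dq}^{(1)}(z_{1,1})&\cdots&B_{n+2dq}^{(q)}(z_{q,2d})&B_{n+2dq}^{(b)}(z) \end{vmatrix}}{\begin{vmatrix} B_n^{(1)}(z_{1,1})&\cdots&B_n^{(q)}(z_{q,2d})\\ \vdots&&\vdots\\ B_{n+2dq-1}^{(1)}(z_{1,1})&\cdots&B_{n+2dq-1}^{(q)}(z_{q,2d}) \end{vmatrix}},$$ where row $m$ of the evaluation part is $\big(B_m^{(1)}(z_{1,1}),\dots,B_m^{(1)}(z_{1,2d}),\dots,B_m^{(q)}(z_{q,1}),\dots,B_m^{(q)}(z_{q,2d})\big)$ and $\tilde N_{C,n}=(N_C)_{n,n+2dq}$.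
   Context: Let $p,q,d\in\mathbb N$ and let $\mu$ be a $q\times p$ matrix of complex Borel measures with infinite support on the unit circle $\mathbb T=\{|z|=1\}$. Rows and columns of semi-infinite matrices are indexed from $0$. For $r\in\mathbb N$, $Z_{[r]}(z)$ is the $\infty\times r$ matrix obtained by stacking the $r\times r$ blocks $I_r, z^{-1}I_r, zI_r, z^{-2}I_r, z^2I_r,\dots$ (block number $2N$ is $z^NI_r$, block number $2N+1$ is $z^{-N-1}I_r$). Let $W_{[q]}(z)=\mathrm{diag}(W_1(z),\dots,W_q(z))$, where each $W_b$ is a balanced Laurent polynomial $W_b(z)=c_bz^{-d}\prod_{\ell=1}^{2d}(z-z_{b,\ell})$, $c_b\neq0$, with $2d$ distinct nonzero zeros, the $2dq$ zeros $z_{b,\ell}$ being all different. The Christoffel perturbed matrix of measures is $\mathrm d\hat\mu(z)=W_{[q]}(z)\,\mathrm d\mu(z)$. The moment matrices are $M=\oint_{\mathbb T}Z_{[q]}(z)\,\mathrm d\mu(z)\,Z_{[p]}^\top(z^{-1})$ and $\hat M=\oint_{\mathbb T}Z_{[q]}(z)\,\mathrm d\hat\mu(z)\,Z_{[p]}^\top(z^{-1})$. It is assumed that both have Gauss--Borel factorizations $M=L^{-1}U^{-1}$, $\hat M=\hat L^{-1}\hat U^{-1}$, with $L,\hat L$ lower triangular and $U,\hat U$ upper triangular semi-infinite matrices with nonzero diagonal entries. Put $B(z)=LZ_{[q]}(z)$, $\hat B(z)=\hat LZ_{[q]}(z)$, with entries $B_n^{(b)}(z),\hat B_n^{(b)}(z)$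 in row $n\in\mathbb N_0$ and column $b\in\{1,\dots,q\}$. The connection matrix is $N_C=\hat U^{-1}U$; it is upper triangular and banded with $2dq$ superdiagonals (entries $(N_C)_{i,j}$ vanish unless $i\le j\le i+2dq$). *)

(* Defs.v *)
From HB Require Import structures.
From mathcomp Require Import all_boot all_order all_algebra.
From mathcomp Require Import complex.
From mathcomp Require Import all_classical all_reals all_analysis.

Set Implicit Arguments.
Unset Strict Implicit.
Unset Printing Implicit Defensive.

Import Order.TTheory GRing.Theory Num.Theory.
Import numFieldNormedType.Exports.

Local Open Scope classical_set_scope.
Local Open Scope ring_scope.
Local Open Scope complex_scope.

(* [R[i]^o] carries the norm topology of the complex plane, and [set_type] the
   topology induced on a subset. *)
Definition circle (R : realType) : Type :=
  set_type [set z : R[i]^o | `|z| = 1].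

HB.instance Definition _ (R : realType) :=
  Topological.copy (circle R) (set_type [set z : R[i]^o | `|z| = 1]).

Lemma circle1_subproof (R : realType) :
  (1 : R[i]^o) \in [set z : R[i]^o | `|z| = 1].
Proof. by rewrite inE /=; exact: normr1. Qed.

(* Generated sigma-algebras are only measurable types over a pointed type. *)
HB.instance Definition _ (R : realType) :=
  isPointed.Build (circle R) (exist _ (1 : R[i]^o) (@circle1_subproof R)).

Notation borel_circle R := (g_sigma_algebraType (@open (circle R))).

Definition circle_coord (R : realType) (x : borel_circle R) : R[i] := \val x.

(* Library charges are countably additive and finite on measurable sets, so
   pairs of charges are exactly the (real part, imaginary part) of complex
   measures. *)
Record complex_measure (R : realType) := ComplexMeasure {
  re_part : {charge set (borel_circle R) -> \bar R} ;
  im_part : {charge set (borel_circle R) -> \bar R} }.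

Definition cmeasure_val (R : realType) (mu : complex_measure R)
    (A : set (borel_circle R)) : R[i] :=
  fine (re_part mu A) +i* fine (im_part mu A).

(* The support of the total variation of [mu]: [|mu|(U) > 0] if and only if
   [mu] does not vanish on all Borel subsets of [U]. *)
Definition cmeasure_support (R : realType) (mu : complex_measure R) :
    set (circle R) :=
  [set x | forall U : set (circle R), open U -> U x ->
    exists A : set (borel_circle R),
      [/\ measurable A, A `<=` U & cmeasure_val mu A != 0]].

Section charge_integral.
Context d (T : measurableType d) (R : realType).
Variable nu : {charge set T -> \bar R}.

Definition hahn_pos : set T := sval (cid (Hahn_decomposition nu)).

Definition hahn_neg : set T := sval (cid (svalP (cid (Hahn_decomposition nu)))).

Lemma hahn_posneg : hahn_decomposition nu hahn_pos hahn_neg.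
Proof. exact: (svalP (cid (svalP (cid (Hahn_decomposition nu))))). Qed.

Definition charge_integral (D : set T) (f : T -> R) : R :=
  \int[jordan_pos hahn_posneg]_(x in D) f x -
  \int[jordan_neg hahn_posneg]_(x in D) f x.

End charge_integral.

Definition cintegral (R : realType) (mu : complex_measure R)
    (D : set (borel_circle R)) (f : borel_circle R -> R[i]) : R[i] :=
  (charge_integral (re_part mu) D (fun x => complex.Re (f x)) -
   charge_integral (im_part mu) D (fun x => complex.Im (f x))) +i*
  (charge_integral (re_part mu) D (fun x => complex.Im (f x)) +
   charge_integral (im_part mu) D (fun x => complex.Re (f x))).

Definition balanced_laurent (R : realType) (q d : nat) (c : 'I_q -> R[i])
    (zz : 'M[R[i]]_(q, 2 * d)) (b : 'I_q) (z : R[i]) : R[i] :=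
  c b * z ^- d * \prod_(l < 2 * d) (z - zz b l).

(* [d muhat = diag(W_1, ..., W_q) d mu], entry by entry. *)
Definition christoffel_perturbed (R : realType) (p q : nat)
    (W : 'I_q -> R[i] -> R[i]) (mu muhat : 'M[complex_measure R]_(q, p)) : Prop :=
  forall (b : 'I_q) (a : 'I_p) (A : set (borel_circle R)), measurable A ->
    cmeasure_val (muhat b a) A = cintegral (mu b a) A (fun x => W b (circle_coord x)).

(* Finitely supported sums: in every product used here, [A] is row finite or
   [B] is column finite.  (The value is 0 on infinite supports.) *)
Definition smx_mul (F : fieldType) (J : Type) (A : nat -> nat -> F)
    (B : nat -> J -> F) : nat -> J -> F :=
  fun i j => \sum_(k \in [set: nat]) A i k * B k j.

Definition smx_id (F : fieldType) : nat -> nat -> F := fun i j => (i == j)%:R.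

Definition lower_tri (F : fieldType) (A : nat -> nat -> F) : Prop :=
  forall i j : nat, (i < j)%N -> A i j = 0.

Definition upper_tri (F : fieldType) (A : nat -> nat -> F) : Prop :=
  forall i j : nat, (j < i)%N -> A i j = 0.

Definition smx_inverse (F : fieldType) (A B : nat -> nat -> F) : Prop :=
  smx_mul A B = @smx_id F /\ smx_mul B A = @smx_id F.

Definition lower_inverse (F : fieldType) (L Linv : nat -> nat -> F) : Prop :=
  lower_tri Linv /\ smx_inverse L Linv.

Definition upper_inverse (F : fieldType) (U Uinv : nat -> nat -> F) : Prop :=
  upper_tri Uinv /\ smx_inverse U Uinv.

Definition gauss_borel (F : fieldType) (M L U : nat -> nat -> F) : Prop :=
  [/\ lower_tri L, upper_tri U,
      forall i, L i i != 0, forall i, U i i != 0 &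
      exists Linv Uinv : nat -> nat -> F,
        [/\ lower_inverse L Linv, upper_inverse U Uinv &
            M = smx_mul Linv Uinv]].

Definition block_exponent (k : nat) : int :=
  if odd k then - (k./2.+1)%:Z else (k./2)%:Z.

(* Row [i] of [Z_[r](z)] is row [i %% r] of its block number [i %/ r]. *)
Definition Zmx (R : realType) (r : nat) (z : R[i]) : nat -> 'I_r -> R[i] :=
  fun i b => if (i %% r)%N == b then z ^ block_exponent (i %/ r) else 0.

Definition moment_mx (R : realType) (p q : nat)
    (mu : 'M[complex_measure R]_(q, p)) : nat -> nat -> R[i] :=
  fun i j => \sum_(b < q) \sum_(a < p)
    cintegral (mu b a) [set: borel_circle R]
      (fun x => Zmx (circle_coord x) i b * Zmx (circle_coord x)^-1 j a).

Definition Bmx (R : realType) (q : nat) (L : nat -> nat -> R[i]) (z : R[i]) :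
    nat -> 'I_q -> R[i] :=
  smx_mul L (Zmx z).

(* [mxvec] lists the values at the zeros row by row, i.e. in the order
   [z_(1,1), ..., z_(1,2d), ..., z_(q,1), ..., z_(q,2d)]. *)
Definition zeros_row (R : realType) (q d : nat) (L : nat -> nat -> R[i])
    (zz : 'M[R[i]]_(q, 2 * d)) (m : nat) : 'rV[R[i]]_(q * (2 * d)) :=
  mxvec (\matrix_(b < q, l < 2 * d) Bmx L (zz b l) m b).

Definition denominator_mx (R : realType) (q d : nat) (L : nat -> nat -> R[i])
    (zz : 'M[R[i]]_(q, 2 * d)) (n : nat) : 'M[R[i]]_(q * (2 * d)) :=
  \matrix_(i < q * (2 * d)) zeros_row L zz (n + i).

Definition numerator_mx (R : realType) (q d : nat) (L : nat -> nat -> R[i])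
    (zz : 'M[R[i]]_(q, 2 * d)) (n : nat) (b : 'I_q) (z : R[i]) :
    'M[R[i]]_(q * (2 * d) + 1) :=
  \matrix_(i < q * (2 * d) + 1)
    row_mx (zeros_row L zz (n + i)) (Bmx L z (n + i) b)%:M.

(* Main.v *)
(* Write W for diag(W_1, ..., W_q).  Multiplication of Z(z) by the Laurent
   polynomials W_b is implemented by a banded scalar matrix S with 2dq
   superdiagonals: S Z(z) = Z(z) W(z).  Integrating against mu, and using that
   integrals against W dmu are integrals of W f against mu, the moment matrices
   satisfy Mhat = S M, so that N_C = Lhat S L^-1 is upper triangular and banded,
   and N_C B(z) = Bhat(z) W(z).  At the zeros of W_b the right-hand side
   vanishes, so row n of this identity is a linear relation among the rows
   n, ..., n + 2dq of the numerator, whose determinant is then computed by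
   replacing the last row with this combination.  Its leading coefficient
   (N_C)_(n, n + 2dq) is nonzero: otherwise the relation would be one among the
   rows of the invertible denominator, forcing the diagonal entry (N_C)_(n, n)
   to vanish. *)
Require Import Defs.
From mathcomp Require Import all_boot all_order all_algebra.
From mathcomp Require Import complex.
From mathcomp Require Import all_classical all_reals all_analysis.
From mathcomp Require Import measurable_realfun zify ring.

Import Order.TTheory GRing.Theory Num.Theory.
Import numFieldNormedType.Exports.
Local Open Scope classical_set_scope.
Local Open Scope ring_scope.
Local Open Scope complex_scope.

Set Implicit Arguments.
Unset Strict Implicit.

(** * Semi-infinite matrices: finite products, associativity, triangular inverses *)

(** Entries below the diagonal are unrestricted: what matters is that rows are finite. Lower
    triangular matrices are the case [w = 0]. *)
Definition banded (F : fieldType) (w : nat) (A : nat -> nat -> F) : Prop :=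
  forall i j : nat, (i + w < j)%N -> A i j = 0.

Section SemiInfinite.
Context {F : fieldType}.
Implicit Types A B C : nat -> nat -> F.

(** Truncation to an ordinary finite sum keeps the default value 0 of infinite sums out of the
    computations. *)
Lemma smx_mulE (J : Type) (K : nat) A (B : nat -> J -> F) (i : nat) (j : J) :
  (forall k, (K <= k)%N -> A i k * B k j = 0) ->
  smx_mul A B i j = \sum_(k < K) A i k * B k j.
Proof.
move=> AB0; rewrite /smx_mul (fsbig_ord _ _ (fun k => A i k * B k j)).
apply/esym/fsbig_widen => // k [_ /= /negP]; rewrite -leqNgt; exact: AB0.
Qed.

Lemma smx_mul_bandedE (J : Type) w A (B : nat -> J -> F) i j K :
  banded w A -> (i + w < K)%N ->
  smx_mul A B i j = \sum_(k < K) A i k * B k j.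
Proof.
move=> bA iK; apply: smx_mulE => k Kk.
by rewrite bA ?mul0r// (leq_trans iK).
Qed.

Lemma smx_mul_upperE A B i j K :
  upper_tri B -> (j < K)%N ->
  smx_mul A B i j = \sum_(k < K) A i k * B k j.
Proof.
move=> uB jK; apply: smx_mulE => k Kk.
by rewrite uB ?mulr0// (leq_trans jK).
Qed.

Lemma lower_tri_banded A : lower_tri A -> banded 0 A.
Proof. by move=> lA i j; rewrite addn0; exact: lA. Qed.

Lemma banded_mul w v A B :
  banded w A -> banded v B -> banded (w + v) (smx_mul A B).
Proof.
move=> bA bB i j ij; rewrite (smx_mul_bandedE _ _ (K := (i + w).+1) bA)//.
by apply: big1 => k _; rewrite bB ?mulr0//; have := ltn_ord k; lia.
Qed.

(** Row [i] of [A] meets finitely many rows of [B], all ending by column [i + w + v], so both sides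
    are finite double sums for any [C]. *)
Lemma smx_mulA (J : Type) w v A B (C : nat -> J -> F) :
  banded w A -> banded v B ->
  smx_mul A (smx_mul B C) = smx_mul (smx_mul A B) C.
Proof.
move=> bA bB; apply/funext => i; apply/funext => j.
rewrite (smx_mul_bandedE _ _ (K := (i + w).+1) bA)//.
rewrite (smx_mul_bandedE _ _ (K := (i + (w + v)).+1) (banded_mul bA bB))//.
under eq_bigr => k _.
  rewrite (smx_mul_bandedE _ _ (K := (i + (w + v)).+1) bB)//; last first.
    by have := ltn_ord k; lia.
  rewrite mulr_sumr; over.
rewrite exchange_big /=; apply: eq_bigr => l _.
rewrite (smx_mul_bandedE _ _ (K := (i + w).+1) bA)// mulr_suml.
by apply: eq_bigr => k _; rewrite mulrA.
Qed.

(** Rows of [A] and columns of [C] are finite, so the middle factor is free. *)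
Lemma smx_mulA_banded_upper w A B C :
  banded w A -> upper_tri C ->
  smx_mul A (smx_mul B C) = smx_mul (smx_mul A B) C.
Proof.
move=> bA uC; apply/funext => i; apply/funext => j.
rewrite (smx_mul_bandedE _ _ (K := (i + w).+1) bA)//.
rewrite (smx_mul_upperE _ _ (K := j.+1))//.
under eq_bigr => k _ do rewrite (smx_mul_upperE _ _ (K := j.+1))// mulr_sumr.
rewrite exchange_big /=; apply: eq_bigr => l _.
rewrite (smx_mul_bandedE _ _ (K := (i + w).+1) bA)// mulr_suml.
by apply: eq_bigr => k _; rewrite mulrA.
Qed.

Lemma smx_mulA_upper A B C : upper_tri B -> upper_tri C ->
  smx_mul A (smx_mul B C) = smx_mul (smx_mul A B) C.
Proof.
move=> uB uC; apply/funext => i; apply/funext => j.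
rewrite (smx_mulE (K := j.+1)); last first.
  move=> k jk; rewrite (smx_mul_upperE _ _ (K := j.+1))// big1 ?mulr0// => l _.
  by rewrite uB ?mul0r//; have := ltn_ord l; lia.
rewrite (smx_mul_upperE _ _ (K := j.+1))//.
under eq_bigr => k _ do rewrite (smx_mul_upperE _ _ (K := j.+1))// mulr_sumr.
rewrite exchange_big /=; apply: eq_bigr => l _.
rewrite (smx_mul_upperE _ _ (K := j.+1))//.
by rewrite mulr_suml; apply: eq_bigr => k _; rewrite mulrA.
Qed.

Lemma smx_mul1l (J : Type) (B : nat -> J -> F) : smx_mul (@smx_id F) B = B.
Proof.
apply/funext => i; apply/funext => j; rewrite (smx_mulE (K := i.+1)); last first.
  by move=> k ik; rewrite /smx_id ltn_eqF ?mul0r.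
rewrite (bigD1 ord_max)//= /smx_id eqxx mul1r big1 ?addr0// => k.
by rewrite -val_eqE /= eq_sym => /negbTE ->; rewrite mul0r.
Qed.

Lemma smx_mul1r A : smx_mul A (@smx_id F) = A.
Proof.
apply/funext => i; apply/funext => j; rewrite (smx_mulE (K := j.+1)); last first.
  by move=> k jk; rewrite /smx_id gtn_eqF ?mulr0.
rewrite (bigD1 ord_max)//= /smx_id eqxx mulr1 big1 ?addr0// => k.
by rewrite -val_eqE /= => /negbTE ->; rewrite mulr0.
Qed.

Lemma upper_tri_mul A B : upper_tri A -> upper_tri B -> upper_tri (smx_mul A B).
Proof.
move=> uA uB i j ji; rewrite (smx_mul_upperE _ _ (K := j.+1))// big1// => k _.
by rewrite uA ?mul0r//; have := ltn_ord k; lia.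
Qed.

Lemma upper_tri_mul_diag A B i :
  upper_tri A -> upper_tri B -> smx_mul A B i i = A i i * B i i.
Proof.
move=> uA uB; rewrite (smx_mul_upperE _ _ (K := i.+1))// big_ord_recr /= big1.
  by rewrite add0r.
by move=> k _; rewrite uA ?mul0r.
Qed.

(** The usual [B = B(AC) = (BA)C = C]. It identifies a given inverse with the one quantified inside
    [gauss_borel]. *)
Lemma upper_inverse_uniq A B C :
  upper_tri A -> upper_inverse A B -> upper_inverse A C -> B = C.
Proof.
move=> uA [uB [_ BA]] [uC [AC _]].
by rewrite -[LHS]smx_mul1r -AC smx_mulA_upper// BA smx_mul1l.
Qed.

Lemma upper_inverse_diag_neq0 A B i :
  upper_tri A -> upper_inverse A B -> B i i != 0.
Proof.
move=> uA [uB [AB _]]; have := upper_tri_mul_diag i uA uB.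
rewrite AB /smx_id eqxx; apply: contra_eq_neq => ->.
by rewrite mulr0 oner_eq0.
Qed.

End SemiInfinite.

(* Left multiplication by the identity matrix with last row [row_mx v a%:M]
   turns the last row into [row_mx 0 t%:M]. *)
Lemma det_bordered (F : comPzRingType) (K : nat) (D : 'M[F]_K) (c : 'cV[F]_K)
    (r v : 'rV[F]_K) (s t a : F) :
  v *m D + a *: r = 0 -> v *m c + a%:M *m s%:M = t%:M ->
  a * \det (block_mx D c r s%:M) = \det D * t.
Proof.
move=> hr hs; have -> : a = \det (block_mx 1%:M 0 v a%:M).
  by rewrite det_lblock det1 mul1r det_scalar1.
rewrite -det_mulmx mulmx_block !mul1mx !mul0mx !addr0 hs mul_scalar_mx hr.
by rewrite det_ublock det_scalar1.
Qed.

(** * Bounded measurable real functions *)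

Section BoundedMeasurable.
Context d (T : measurableType d) (R : realType).
Implicit Types (f g : T -> R) (A : set T).

(** Boundedness, unlike integrability, is stable under products and independent of the measure. *)
Definition bounded_measurable f : Prop :=
  measurable_fun setT f /\ exists M, forall x, `|f x| <= M.

Lemma bounded_measurable_cst (c : R) : bounded_measurable (fun=> c).
Proof. by split=> //; exists `|c|. Qed.

Lemma bounded_measurable_indic A :
  measurable A -> bounded_measurable (\1_A : T -> R).
Proof.
move=> mA; split; first exact: measurable_indic.
by exists 1 => x; rewrite indicE ger0_norm ?ler0n// lern1 leq_b1.
Qed.

Lemma bounded_measurableD f g : bounded_measurable f ->
  bounded_measurable g -> bounded_measurable (fun x => f x + g x).
Proof.
move=> [mf [M fM]] [mg [K gK]]; split; first exact: measurable_funD.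
by exists (M + K) => x; rewrite (le_trans (ler_normD _ _))// lerD.
Qed.

Lemma bounded_measurableM f g : bounded_measurable f ->
  bounded_measurable g -> bounded_measurable (fun x => f x * g x).
Proof.
move=> [mf [M fM]] [mg [K gK]]; split; first exact: measurable_funM.
by exists (M * K) => x; rewrite normrM ler_pM.
Qed.

Lemma bounded_measurableZ (c : R) f :
  bounded_measurable f -> bounded_measurable (fun x => c * f x).
Proof. exact/bounded_measurableM/bounded_measurable_cst. Qed.

Lemma bounded_measurableB f g : bounded_measurable f ->
  bounded_measurable g -> bounded_measurable (fun x => f x - g x).
Proof.
move=> bf bg; under eq_fun do rewrite -mulN1r.
by apply: bounded_measurableD => //; exact: bounded_measurableZ.
Qed.

Lemma bounded_measurable_integrable
    (m : {finite_measure set T -> \bar R}) f :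
  bounded_measurable f -> m.-integrable setT (EFin \o f).
Proof.
move=> [mf [M fM]]; apply: measurable_bounded_integrable => //.
  by rewrite ltey_eq fin_num_measure.
exists M; split=> [|y My x _]; first exact: num_real.
  exact: le_trans (fM x) (ltW My).
Qed.

(* Removing [e * \1_(e <= f)] from [f] lowers its upper bound by [e] without
   changing [F f], so only values below [e] matter. *)
Lemma functional_indic_eq0 (F : (T -> R) -> R) (C : R) :
  (forall f g, bounded_measurable f -> bounded_measurable g ->
     F (fun x => f x + g x) = F f + F g) ->
  (forall c f, bounded_measurable f -> F (fun x => c * f x) = c * F f) ->
  (forall f (M : R), measurable_fun setT f -> (forall x, `|f x| <= M) ->
     `|F f| <= C * M) ->
  (forall A, measurable A -> F \1_A = 0) ->
  forall f, bounded_measurable f -> F f = 0.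
Proof.
move=> FD FZ Fb F1.
(* The bound does not depend on the number [N] of layers, so [e] can be taken arbitrarily small
   afterwards. *)
have small (e : R) : 0 < e -> forall N f, measurable_fun setT f ->
    (forall x, 0 <= f x <= N.+1%:R * e) -> `|F f| <= C * e.
  move=> e0; elim=> [|N IH] f mf f01.
    by apply: Fb => // x; have := f01 x; rewrite mul1r => /andP[/ger0_norm->].
  pose A := f @^-1` `[e, +oo[.
  have mA : measurable A by rewrite -[A]setTI; apply: mf.
  have bf : bounded_measurable f.
    split=> //; exists (N.+2%:R * e) => x.
    by have /andP[/ger0_norm->] := f01 x.
  have b1 := bounded_measurable_indic mA.
  have bg := bounded_measurableB bf (bounded_measurableZ e b1).
  have -> : F f = F (fun x => f x - e * \1_A x).
    under [in RHS]eq_fun do rewrite -mulNr.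
    rewrite FD//; last exact: bounded_measurableZ.
    by rewrite FZ// F1// mulr0 addr0.
  apply: IH bg.1 _ => x; have /andP[f0 fN] := f01 x.
  rewrite indicE; case: (boolP (x \in A)) => [|/negP]; rewrite inE /A /= in_itv/= andbT.
    by move=> ef; rewrite mulr1 subr_ge0 ef lerBlDr -{2}[e]mul1r -mulrDl natr1.
  move=> /negP; rewrite -ltNge mulr0 subr0 f0 => /ltW fe.
  by apply: le_trans fe _; apply: ler_peMl; [exact: ltW|rewrite ler1n].
move=> f [mf [M fM]].
have [M0|M0] := leP M 0.
  have f0 : f = fun x => 0 * \1_[set: T] x.
    apply/funext => x; apply/eqP; rewrite mul0r -normr_le0.
    exact: le_trans (fM x) M0.
  by rewrite f0 FZ ?mul0r//; exact: bounded_measurable_indic.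
have bM := bounded_measurableZ M (bounded_measurable_indic (@measurableT _ T)).
have bf : bounded_measurable f by split=> //; exists M.
(* Adding the constant [M] moves the values into [[0, 2M]] without changing [F f]. *)
have -> : F f = F (fun x => f x + M * \1_[set: T] x).
  by rewrite FD// FZ ?F1 ?mulr0 ?addr0//; exact: bounded_measurable_indic.
apply/eqP; rewrite -normr_le0; apply/ler_addgt0Pr => e e0; rewrite add0r.
have C0 : 0 <= C.
  by rewrite -(pmulr_lge0 _ M0); apply: le_trans (Fb _ _ mf fM).
(* The denominator [C + 1] is positive even if [C = 0], and [C * e' <= e]. *)
pose e' := e / (C + 1).
have e'0 : 0 < e' by rewrite divr_gt0// ltr_wpDl.
apply: (@le_trans _ _ (C * e')); last first.
  rewrite /e' mulrCA ger_pMr// ler_pdivrMr ?mul1r ?lerDl//.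
  by rewrite ltr_wpDl.
apply: (small _ e'0 (Num.truncn (2 * M / e'))).
  exact: (bounded_measurableD bf bM).1.
move=> x; rewrite indicT mulr1; have := fM x; rewrite ler_norml => /andP[f1 f2].
rewrite -lerBlDr sub0r f1/= -ler_pdivrMr//.
rewrite (le_trans _ (ltW (truncnS_gt _)))// ler_pM2r ?invr_gt0//.
by rewrite mulr_natl mulr2n lerD2r.
Qed.

End BoundedMeasurable.

(** * Integration against real charges *)

Section ChargeIntegral.
Context d (T : measurableType d) (R : realType).
Variable nu : {charge set T -> \bar R}.
Implicit Types (f g : T -> R) (A : set T).

Notation np := (jordan_pos (hahn_posneg nu)).
Notation nn := (jordan_neg (hahn_posneg nu)).

Lemma charge_integralD f g : bounded_measurable f -> bounded_measurable g ->
  charge_integral nu setT (fun x => f x + g x) =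
  charge_integral nu setT f + charge_integral nu setT g.
Proof.
move=> bf bg; rewrite /charge_integral !RintegralD//;
  try exact: bounded_measurable_integrable.
by rewrite opprD addrACA.
Qed.

Lemma charge_integralZ (c : R) f : bounded_measurable f ->
  charge_integral nu setT (fun x => c * f x) = c * charge_integral nu setT f.
Proof.
move=> bf; rewrite /charge_integral !RintegralZl//;
  try exact: bounded_measurable_integrable.
by rewrite mulrBr.
Qed.

Lemma charge_integralB f g : bounded_measurable f -> bounded_measurable g ->
  charge_integral nu setT (fun x => f x - g x) =
  charge_integral nu setT f - charge_integral nu setT g.
Proof.
move=> bf bg; under [in LHS]eq_fun do rewrite -mulN1r.
by rewrite charge_integralD ?charge_integralZ ?mulN1r//;
  exact: bounded_measurableZ.
Qed.

(** Each Jordan part is bounded separately; the constant is the mass of the total variation of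
    [nu]. *)
Lemma charge_integral_le f (M : R) : measurable_fun setT f ->
  (forall x, `|f x| <= M) ->
  `|charge_integral nu setT f| <=
    (fine (np setT) + fine (nn setT)) * M.
Proof.
move=> mf fM; have bf : bounded_measurable f by split=> //; exists M.
have bn : bounded_measurable (fun x => `|f x|).
  split; first exact: measurableT_comp.
  by exists M => x; rewrite normr_id.
have le_m (m : {finite_measure set T -> \bar R}) :
    `|\int[m]_x f x| <= fine (m setT) * M.
  rewrite (le_trans (le_normr_Rintegral _ _))//.
    exact: bounded_measurable_integrable.
  rewrite mulrC -Rintegral_cst//; apply: le_Rintegral => //.
    exact: bounded_measurable_integrable.
  exact/bounded_measurable_integrable/bounded_measurable_cst.
rewrite mulrDl (le_trans (ler_normB _ _))//.
by apply: lerD; exact: le_m.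
Qed.

Lemma charge_integral_indic A : measurable A ->
  charge_integral nu setT \1_A = fine (nu A).
Proof.
move=> mA; rewrite /charge_integral /Rintegral !integral_indic// setIT.
rewrite (jordan_decomp (hahn_posneg nu) mA) /cadd/= cscaleN1.
by rewrite fineB// fin_num_measure.
Qed.

Lemma charge_integral_mkcond A f :
  charge_integral nu A f = charge_integral nu setT (fun x => \1_A x * f x).
Proof.
have E : (fun x => \1_A x * f x) = patch (fun=> 0) A f.
  by apply/funext => x; rewrite patchE indicE; case: ifP; rewrite ?mul1r ?mul0r.
by rewrite /charge_integral E !(Rintegral_mkcond _ A).
Qed.

End ChargeIntegral.

(* Both sides are bounded functionals of [f] that agree on indicators; this
   avoids relating the Hahn decompositions of [nu], [nu1] and [nu2]. *)
Lemma charge_integral_density d (T : measurableType d) (R : realType)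
    (nu nu1 nu2 : {charge set T -> \bar R}) (g1 g2 f : T -> R) :
  bounded_measurable g1 -> bounded_measurable g2 -> bounded_measurable f ->
  (forall A, measurable A ->
     fine (nu A) = charge_integral nu1 A g1 + charge_integral nu2 A g2) ->
  charge_integral nu setT f =
    charge_integral nu1 setT (fun x => f x * g1 x) +
    charge_integral nu2 setT (fun x => f x * g2 x).
Proof.
move=> b1 b2 bf nuE; apply/eqP; rewrite -subr_eq0; apply/eqP.
pose F (h : T -> R) := charge_integral nu setT h -
    (charge_integral nu1 setT (fun x => h x * g1 x) +
     charge_integral nu2 setT (fun x => h x * g2 x)).
rewrite -/(F f).
have [M1 g1M] := b1.2; have [M2 g2M] := b2.2.
(* [C m] is the mass of the total variation of [m]; in the bound for [F], those of [nu1] and [nu2]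
   are weighted by the bounds of [g1] and [g2]. *)
pose C (m : {charge set T -> \bar R}) :=
  fine (jordan_pos (hahn_posneg m) setT) + fine (jordan_neg (hahn_posneg m) setT).
apply: (functional_indic_eq0 (F := F) (C := C nu + (C nu1 * M1 + C nu2 * M2))) => //.
- move=> h k bh bk; rewrite /F.
  have E (g : T -> R) : (fun x => (h x + k x) * g x) =
      (fun x => h x * g x + k x * g x) by apply/funext => x; rewrite mulrDl.
  rewrite !E !charge_integralD//; try exact: bounded_measurableM.
  ring.
- move=> c h bh; rewrite /F.
  have E (g : T -> R) : (fun x => c * h x * g x) =
      (fun x => c * (h x * g x)) by apply/funext => x; rewrite mulrA.
  rewrite !E !charge_integralZ//; try exact: bounded_measurableM.
  ring.
- move=> h M mh hM; have bh : bounded_measurable h by split=> //; exists M.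
  rewrite mulrDl (le_trans (ler_normB _ _))// lerD//; first exact: charge_integral_le.
  rewrite mulrDl (le_trans (ler_normD _ _))// lerD// -mulrA [X in _ * X]mulrC.
    apply: charge_integral_le; first exact: (bounded_measurableM bh b1).1.
    by move=> x; rewrite normrM ler_pM.
  apply: charge_integral_le; first exact: (bounded_measurableM bh b2).1.
  by move=> x; rewrite normrM ler_pM.
- move=> A mA; rewrite /F charge_integral_indic// -!charge_integral_mkcond.
  by rewrite nuE// subrr.
Qed.

(** * Complex-valued bounded measurable functions *)

Lemma Re_mul (R : rcfType) (x y : R[i]) :
  complex.Re (x * y) =
  complex.Re x * complex.Re y - complex.Im x * complex.Im y.
Proof. by case: x; case: y. Qed.

Lemma Im_mul (R : rcfType) (x y : R[i]) :
  complex.Im (x * y) =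
  complex.Re x * complex.Im y + complex.Im x * complex.Re y.
Proof. by case: x; case: y. Qed.

Lemma normc_ge_Im (R : rcfType) (x : R[i]) : `|complex.Im x|%:C <= `|x|.
Proof.
case: x => a b /=; rewrite lecR -[`|b|]sqrtr_sqr ler_wsqrtr// lerDr.
exact: sqr_ge0.
Qed.

Section ComplexBoundedMeasurable.
Context d (T : measurableType d) (R : realType).
Implicit Types f g : T -> R[i].

Definition complex_bounded_measurable f : Prop :=
  bounded_measurable (fun x => complex.Re (f x)) /\
  bounded_measurable (fun x => complex.Im (f x)).

Lemma complex_bounded_measurable_cst (c : R[i]) :
  complex_bounded_measurable (fun=> c).
Proof. by split; exact: bounded_measurable_cst. Qed.

Lemma complex_bounded_measurableD f g :
  complex_bounded_measurable f -> complex_bounded_measurable g ->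
  complex_bounded_measurable (fun x => f x + g x).
Proof.
move=> [rf jf] [rg jg]; split; under eq_fun do rewrite raddfD /=;
  exact: bounded_measurableD.
Qed.

Lemma complex_bounded_measurableM f g :
  complex_bounded_measurable f -> complex_bounded_measurable g ->
  complex_bounded_measurable (fun x => f x * g x).
Proof.
move=> [rf jf] [rg jg]; split.
  under eq_fun do rewrite Re_mul.
  by apply: bounded_measurableB; exact: bounded_measurableM.
under eq_fun do rewrite Im_mul.
by apply: bounded_measurableD; exact: bounded_measurableM.
Qed.

Lemma complex_bounded_measurable_sum (I : Type) (r : seq I) (F : I -> T -> R[i]) :
  (forall i, complex_bounded_measurable (F i)) ->
  complex_bounded_measurable (fun x => \sum_(i <- r) F i x).
Proof.
move=> bF; elim: r => [|i r IH].
  under eq_fun do rewrite big_nil; exact: complex_bounded_measurable_cst.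
under eq_fun do rewrite big_cons; exact: complex_bounded_measurableD.
Qed.

Lemma complex_bounded_measurableX f k :
  complex_bounded_measurable f -> complex_bounded_measurable (fun x => f x ^+ k).
Proof.
move=> bf; elim: k => [|k IH]; first exact: complex_bounded_measurable_cst.
by under eq_fun do rewrite exprS; exact: complex_bounded_measurableM.
Qed.

End ComplexBoundedMeasurable.

(** * Integration against complex measures on the circle *)

Section CircleIntegral.
Context (R : realType).
Implicit Types (mu : complex_measure R) (f g : borel_circle R -> R[i]).

(** A 1-Lipschitz function is continuous on the plane, hence on the circle with the induced
    topology. Real and imaginary parts are the intended cases. *)
Lemma open_circle_preimage (h : R[i] -> R) (U : set R) :
  (forall z w, `|h z - h w|%:C <= `|z - w|) -> open U ->
  open ((fun x : circle R => h (val x)) @^-1` U).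
Proof.
move=> hlip oU.
have oV : open ((h : R[i]^o -> R) @^-1` U).
  suff : continuous (h : R[i]^o -> R) by move/continuousP; apply.
  move=> z; apply/(@cvgrPdist_lt _ _ _ (nbhs (z : R[i]^o)) (nbhs_filter _)) => e e0.
  apply/nbhs_ballP; exists e%:C; first by rewrite /= ltcR.
  move=> w; rewrite -ball_normE /= => zw.
  by rewrite -ltcR (le_lt_trans (hlip _ _)).
have cv : continuous (val : circle R -> R[i]^o) by exact: initial_continuous.
by move/continuousP : cv => /(_ _ oV).
Qed.

(** Open intervals generate the Borel sets of [R], and their preimages are open, hence Borel in the
    circle. *)
Lemma measurable_circle_lip (h : R[i] -> R) :
  (forall z w, `|h z - h w|%:C <= `|z - w|) ->
  measurable_fun setT (fun x : borel_circle R => h (circle_coord x)).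
Proof.
move=> hlip; apply: (measurability _ (RGenOpens.measurableE R)).
move=> _ [_ [a [b ->] <-]]; rewrite setTI.
by apply: sub_sigma_algebra; exact/open_circle_preimage/interval_open.
Qed.

Lemma norm_circle_coord (x : borel_circle R) : `|circle_coord x| = 1.
Proof. exact: (set_valP x). Qed.

Lemma circle_coord_neq0 (x : borel_circle R) : circle_coord x != 0.
Proof. by rewrite -normr_gt0 norm_circle_coord. Qed.

Lemma complex_bounded_measurable_coord :
  complex_bounded_measurable (@circle_coord R).
Proof.
split; split.
- apply: measurable_circle_lip => z w; rewrite -raddfB; exact: normc_ge_Re.
- by exists 1 => x; rewrite -lecR (le_trans (normc_ge_Re _))// norm_circle_coord.
- apply: measurable_circle_lip => z w; rewrite -raddfB; exact: normc_ge_Im.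
- by exists 1 => x; rewrite -lecR (le_trans (normc_ge_Im _))// norm_circle_coord.
Qed.

Lemma complex_bounded_measurable_coordV :
  complex_bounded_measurable (fun x : borel_circle R => (circle_coord x)^-1).
Proof.
have [br bi] := complex_bounded_measurable_coord.
(* On the unit circle the inverse is the conjugate. *)
have coordV (x : borel_circle R) : (circle_coord x)^-1 =
    complex.Re (circle_coord x) -i* complex.Im (circle_coord x).
  rewrite invc_norm norm_circle_coord expr1n invr1 mul1r.
  by case: (circle_coord x).
split; under eq_fun do rewrite coordV /=; first by [].
by under eq_fun do rewrite -mulN1r; exact: bounded_measurableZ.
Qed.

Lemma complex_bounded_measurable_coordXz (k : int) :
  complex_bounded_measurable (fun x : borel_circle R => circle_coord x ^ k).
Proof.
case: k => k.
  exact: complex_bounded_measurableX complex_bounded_measurable_coord.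
under eq_fun do rewrite NegzE -exprz_inv.
exact: complex_bounded_measurableX complex_bounded_measurable_coordV.
Qed.

Lemma cintegralD mu f g :
  complex_bounded_measurable f -> complex_bounded_measurable g ->
  cintegral mu setT (fun x => f x + g x) =
  cintegral mu setT f + cintegral mu setT g.
Proof.
move=> [rf jf] [rg jg]; rewrite /cintegral.
have ReD : (fun x => complex.Re (f x + g x)) =
    (fun x => complex.Re (f x) + complex.Re (g x)).
  by apply/funext => x; rewrite raddfD.
have ImD : (fun x => complex.Im (f x + g x)) =
    (fun x => complex.Im (f x) + complex.Im (g x)).
  by apply/funext => x; rewrite raddfD.
rewrite ReD ImD !charge_integralD//.
by apply/eqP; rewrite eq_complex /=; apply/andP; split; apply/eqP; ring.
Qed.

Lemma cintegralZ mu (c : R[i]) f : complex_bounded_measurable f ->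
  cintegral mu setT (fun x => c * f x) = c * cintegral mu setT f.
Proof.
move=> [rf jf]; rewrite /cintegral.
have ReZ : (fun x => complex.Re (c * f x)) =
    (fun x => complex.Re c * complex.Re (f x) - complex.Im c * complex.Im (f x)).
  by apply/funext => x; rewrite Re_mul.
have ImZ : (fun x => complex.Im (c * f x)) =
    (fun x => complex.Re c * complex.Im (f x) + complex.Im c * complex.Re (f x)).
  by apply/funext => x; rewrite Im_mul.
have [rcf icf] := (bounded_measurableZ (complex.Re c) rf,
  bounded_measurableZ (complex.Im c) jf).
have [rcj icr] := (bounded_measurableZ (complex.Re c) jf,
  bounded_measurableZ (complex.Im c) rf).
rewrite ReZ ImZ !charge_integralB// !charge_integralD// !charge_integralZ//.
apply/eqP; rewrite eq_complex Re_mul Im_mul /=.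
by apply/andP; split; apply/eqP; ring.
Qed.

Lemma cintegral_sum mu (I : Type) (r : seq I) (F : I -> borel_circle R -> R[i]) :
  (forall i, complex_bounded_measurable (F i)) ->
  cintegral mu setT (fun x => \sum_(i <- r) F i x) =
  \sum_(i <- r) cintegral mu setT (F i).
Proof.
move=> bF; elim: r => [|i r IH].
  rewrite big_nil; under eq_fun do rewrite big_nil -(mul0r 0).
  by rewrite cintegralZ ?mul0r//; exact: complex_bounded_measurable_cst.
rewrite big_cons -IH -cintegralD//; last exact: complex_bounded_measurable_sum.
by under eq_fun do rewrite big_cons.
Qed.

(** The real and imaginary parts of [nu] each have a density with respect to the two charges of
    [mu], so [charge_integral_density] applies to the real and imaginary parts of [f]. *)
Lemma cintegral_density (mu nu : complex_measure R) (g f : borel_circle R -> R[i]) :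
  complex_bounded_measurable g -> complex_bounded_measurable f ->
  (forall A, measurable A -> cmeasure_val nu A = cintegral mu A g) ->
  cintegral nu setT f = cintegral mu setT (fun x => g x * f x).
Proof.
move=> [rg jg] [rf jf] nuE.
have bN := bounded_measurableZ (-1) jg.
have chargeN (m : {charge set (borel_circle R) -> \bar R}) A h :
    measurable A -> bounded_measurable h ->
    charge_integral m A (fun x => -1 * h x) = - charge_integral m A h.
  move=> mA bh; rewrite !(charge_integral_mkcond _ A).
  have -> : (fun x => \1_A x * (-1 * h x)) = (fun x => -1 * (\1_A x * h x)).
    by apply/funext => x; rewrite mulrCA.
  rewrite charge_integralZ ?mulN1r//; apply: bounded_measurableM => //.
  exact: bounded_measurable_indic.
(* The densities are [Re g] and [- Im g]; the sign is written as a factor [-1] to use homogeneity of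
   the integral. *)
have reE h : bounded_measurable h -> charge_integral (re_part nu) setT h =
    charge_integral (re_part mu) setT (fun x => h x * complex.Re (g x)) +
    charge_integral (im_part mu) setT (fun x => h x * (-1 * complex.Im (g x))).
  move=> bh; apply: charge_integral_density => // A mA.
  by have [-> _] := nuE A mA; rewrite chargeN.
have imE h : bounded_measurable h -> charge_integral (im_part nu) setT h =
    charge_integral (re_part mu) setT (fun x => h x * complex.Im (g x)) +
    charge_integral (im_part mu) setT (fun x => h x * complex.Re (g x)).
  move=> bh; apply: charge_integral_density => // A mA.
  by have [_ ->] := nuE A mA.
have hN (h : borel_circle R -> R) :
    (fun x => h x * (-1 * complex.Im (g x))) =
    (fun x => -1 * (h x * complex.Im (g x))).
  by apply/funext => x; rewrite mulrCA.
have ReM : (fun x => complex.Re (g x * f x)) =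
    (fun x => complex.Re (f x) * complex.Re (g x) -
              complex.Im (f x) * complex.Im (g x)).
  by apply/funext => x; rewrite Re_mul; ring.
have ImM : (fun x => complex.Im (g x * f x)) =
    (fun x => complex.Re (f x) * complex.Im (g x) +
              complex.Im (f x) * complex.Re (g x)).
  by apply/funext => x; rewrite Im_mul; ring.
have [rr ri] := (bounded_measurableM rf rg, bounded_measurableM rf jg).
have [ir ii] := (bounded_measurableM jf rg, bounded_measurableM jf jg).
rewrite /cintegral !reE// !imE// !hN ReM ImM.
rewrite !charge_integralZ// !charge_integralB// !charge_integralD//.
by apply/eqP; rewrite eq_complex /=; apply/andP; split; apply/eqP; ring.
Qed.

End CircleIntegral.

(** * Multiplication by Laurent polynomials as a banded matrix *)

(** Number of the block of [Z] holding [z ^ e]; [Negz k] is [-(k + 1)], hence the odd block. *)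
Definition block_index (e : int) : nat :=
  match e with Posz k => k.*2 | Negz k => k.*2.+1 end.

Lemma block_indexK e : block_exponent (block_index e) = e.
Proof.
case: e => k; rewrite /block_exponent /=; first by rewrite odd_double doubleK.
by rewrite odd_double /= uphalf_double NegzE.
Qed.

(** A unit step of the exponent raises the block number by at most two, and [|m - d| <= d]. *)
Lemma block_index_shift (k m d : nat) : (m <= 2 * d)%N ->
  (block_index (block_exponent k + (m%:Z - d%:Z)) <= k + 2 * d)%N.
Proof.
move=> md; case E: (block_exponent k + _) => [e|e] /=; move: E;
  rewrite /block_exponent; have := odd_double_half k; case: (odd k) => /=; lia.
Qed.

Section LaurentShift.
Context (R : realType) (q d : nat).
Hypothesis q_gt0 : (0 < q)%N.
Variables (c : 'I_q -> R[i]) (zz : 'M[R[i]]_(q, 2 * d)).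

(** [z ^ d * W_b] is a polynomial of degree at most [2d], and [w b] lists its coefficients. *)
Lemma balanced_laurentE : exists w : 'I_q -> nat -> R[i],
  forall b z, z != 0 -> balanced_laurent c zz b z =
    \sum_(m < (2 * d).+1) w b m * z ^ (m%:Z - d%:Z).
Proof.
pose P b : {poly R[i]} := c b *: \prod_(l < 2 * d) ('X - (zz b l)%:P).
exists (fun b m => (P b)`_m) => b z z0.
have sP : (size (P b) <= (2 * d).+1)%N.
  rewrite (leq_trans (size_scale_leq _ _))// -big_enum /=.
  by rewrite size_prod_XsubC size_enum_ord.
have -> : balanced_laurent c zz b z = z ^- d * (P b).[z].
  rewrite /balanced_laurent hornerZ horner_prod mulrCA mulrA; congr (_ * _).
  by apply: eq_bigr => l _; rewrite hornerXsubC.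
rewrite (horner_coef_wide _ sP) mulr_sumr; apply: eq_bigr => m _.
by rewrite mulrCA expfzDr// exprnN [X in _ * X]mulrC.
Qed.

(** Row of [Z] reached from row [i] on multiplying by [z ^ (m - d)]: the block changes, the position
    inside it does not. *)
Definition shift_index (i m : nat) : nat :=
  (block_index (block_exponent (i %/ q) + (m%:Z - d%:Z)) * q + i %% q)%N.

Lemma shift_index_le i m : (m <= 2 * d)%N ->
  (shift_index i m <= i + 2 * d * q)%N.
Proof.
move=> md; rewrite {2}(divn_eq i q) addnAC leq_add2r -mulnDl leq_mul2r.
by rewrite block_index_shift ?orbT.
Qed.

Lemma Zmx_shift_index (z : R[i]) i m (b : 'I_q) : z != 0 ->
  Zmx z (shift_index i m) b = z ^ (m%:Z - d%:Z) * Zmx z i b.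
Proof.
move=> z0; rewrite /Zmx /shift_index modnMDl modn_mod divnMDl//.
rewrite (divn_small (ltn_pmod _ q_gt0)) addn0 block_indexK.
by case: ifP => _; rewrite ?mulr0// expfzDr// mulrC.
Qed.

Lemma laurent_shift_mx : exists2 S : nat -> nat -> R[i],
  banded (2 * d * q) S &
  forall z, z != 0 ->
    smx_mul S (Zmx z) = fun i b => balanced_laurent c zz b z * Zmx z i b.
Proof.
have [w wE] := balanced_laurentE.
(* Row [i] of [Z] lives in column [i %% q], so only the coefficients of that Laurent polynomial
   enter; each is placed in the column of the shifted row. *)
pose S i k := \sum_(b < q) \sum_(m < (2 * d).+1)
  (i %% q == b)%N%:R * w b m * (k == shift_index i m)%:R.
have bS : banded (2 * d * q) S.
  move=> i k ik; apply: big1 => b _; apply: big1 => m _.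
  rewrite [k == _]gtn_eqF ?mulr0// (leq_ltn_trans _ ik)// shift_index_le//.
  by rewrite -ltnS.
exists S => // z z0; apply/funext => i; apply/funext => b.
rewrite (smx_mul_bandedE _ _ (K := (i + 2 * d * q).+1) bS)//.
transitivity (\sum_(b' < q) \sum_(m < (2 * d).+1)
    (i %% q == b')%N%:R * w b' m * Zmx z (shift_index i m) b).
  under eq_bigr => k _ do rewrite mulr_suml.
  rewrite exchange_big /=; apply: eq_bigr => b' _.
  under eq_bigr => k _ do rewrite mulr_suml.
  rewrite exchange_big /=; apply: eq_bigr => m _.
  have sK : (shift_index i m < (i + 2 * d * q).+1)%N.
    by rewrite ltnS shift_index_le// -ltnS.
  rewrite (bigD1 (Ordinal sK))//= eqxx mulr1 big1 ?addr0// => k.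
  by rewrite -val_eqE /= => /negbTE ->; rewrite mulr0 mul0r.
rewrite (bigD1 b)//= [X in _ + X]big1 ?addr0 => [|b' b'b].
  rewrite wE// mulr_suml; apply: eq_bigr => m _.
  rewrite Zmx_shift_index// mulrA /Zmx; case: eqP => _; last by rewrite !mulr0.
  by rewrite mul1r.
apply: big1 => m _; rewrite Zmx_shift_index// /Zmx.
case: eqP => [->|]; last by rewrite !mul0r.
by rewrite val_eqE (negbTE b'b) !mulr0.
Qed.

End LaurentShift.

(** * Moment matrix of the perturbed measures *)

Section Moments.
Context (R : realType).

Lemma complex_bounded_measurable_Zmx (r i : nat) (b : 'I_r) :
  complex_bounded_measurable (fun x : borel_circle R => Zmx (circle_coord x) i b).
Proof.
rewrite /Zmx; case: eqP => _; last exact: complex_bounded_measurable_cst.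
exact: complex_bounded_measurable_coordXz.
Qed.

Lemma complex_bounded_measurable_ZmxV (r i : nat) (b : 'I_r) :
  complex_bounded_measurable
    (fun x : borel_circle R => Zmx (circle_coord x)^-1 i b).
Proof.
rewrite /Zmx; case: eqP => _; last exact: complex_bounded_measurable_cst.
under eq_fun do rewrite exprz_inv.
exact: complex_bounded_measurable_coordXz.
Qed.

Lemma complex_bounded_measurable_laurent (q d : nat) (c : 'I_q -> R[i])
    (zz : 'M[R[i]]_(q, 2 * d)) (b : 'I_q) :
  complex_bounded_measurable
    (fun x : borel_circle R => balanced_laurent c zz b (circle_coord x)).
Proof.
have [w wE] := balanced_laurentE c zz.
under eq_fun => x do rewrite wE ?circle_coord_neq0//.
apply: complex_bounded_measurable_sum => m.
apply: complex_bounded_measurableM; first exact: complex_bounded_measurable_cst.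
exact: complex_bounded_measurable_coordXz.
Qed.

(** The density moves [W_b] into the integrand, where it acts on [Z] as [S]. Rows of [S] are finite,
    so linearity alone takes [S] out of the integral. *)
Lemma moment_mx_perturbed (p q d : nat) (c : 'I_q -> R[i])
    (zz : 'M[R[i]]_(q, 2 * d)) (mu muhat : 'M[complex_measure R]_(q, p))
    (S : nat -> nat -> R[i]) (w : nat) :
  christoffel_perturbed (balanced_laurent c zz) mu muhat ->
  banded w S ->
  (forall z, z != 0 ->
     smx_mul S (Zmx z) = fun i b => balanced_laurent c zz b z * Zmx z i b) ->
  moment_mx muhat = smx_mul S (moment_mx mu).
Proof.
move=> hmuhat bS SZ; apply/funext => i; apply/funext => j.
rewrite (smx_mul_bandedE _ _ (K := (i + w).+1) bS)// /moment_mx.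
under [RHS]eq_bigr => k _ do rewrite mulr_sumr.
rewrite [RHS]exchange_big /=; apply: eq_bigr => b _.
under [RHS]eq_bigr => k _ do rewrite mulr_sumr.
rewrite [RHS]exchange_big /=; apply: eq_bigr => a _.
have bZ k : complex_bounded_measurable (fun x : borel_circle R =>
    Zmx (circle_coord x) k b * Zmx (circle_coord x)^-1 j a).
  apply: complex_bounded_measurableM; first exact: complex_bounded_measurable_Zmx.
  exact: complex_bounded_measurable_ZmxV.
rewrite (cintegral_density (mu := mu b a)
  (complex_bounded_measurable_laurent c zz b) (bZ i)); last exact: hmuhat.
under [RHS]eq_bigr => k _ do rewrite -cintegralZ//.
rewrite -cintegral_sum; last first.
  move=> k; apply: complex_bounded_measurableM => //.
  exact: complex_bounded_measurable_cst.
congr cintegral; apply/funext => x.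
have := congr1 (fun f => f i b) (SZ _ (circle_coord_neq0 x)).
rewrite (smx_mul_bandedE _ _ (K := (i + w).+1) bS)// mulrA => <-.
by rewrite mulr_suml; apply: eq_bigr => k _; rewrite mulrA.
Qed.

End Moments.

(** * Band recurrences and the connection matrix *)

Section Recurrence.
Context (F : fieldType).
Implicit Types A N : nat -> nat -> F.

(** The outermost superdiagonal is set apart: it becomes the coefficient of the last row in the
    bordered determinant. *)
Lemma smx_mul_band (J : Type) w N (B : nat -> J -> F) n j :
  upper_tri N -> banded w N ->
  smx_mul N B n j = \sum_(k < w) N n (n + k)%N * B (n + k)%N j +
                    N n (n + w)%N * B (n + w)%N j.
Proof.
move=> uN bN; rewrite (smx_mul_bandedE _ _ (K := (n + w).+1) bN)//.
rewrite -addnS big_split_ord /= big1 ?add0r => [|k _]; first by rewrite big_ord_recr.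
by rewrite uN ?mul0r.
Qed.

(** [Uhat^-1 = Lhat Mhat = Lhat S L^-1 U^-1], and multiplying by [U] on the right cancels [U^-1]. *)
Lemma connection_mx (w : nat) (S L U Linv Uinv Lhat Uhat Uhatinv M : nat -> nat -> F) :
  banded w S -> M = smx_mul Linv Uinv -> upper_tri U ->
  lower_inverse L Linv -> upper_inverse U Uinv ->
  gauss_borel (smx_mul S M) Lhat Uhat -> upper_inverse Uhat Uhatinv ->
  smx_mul Uhatinv U = smx_mul (smx_mul Lhat S) Linv.
Proof.
move=> bS ME uU [lLi _] [_ [_ UiU]].
case=> lLh uUh _ _ [Lhi [Uhi [iLh iUh MhE]]] iUhat; rewrite {}ME in MhE.
have [lLhi [LhLhi _]] := iLh.
have [[bLh bLi] bLhi] := (lower_tri_banded lLh, lower_tri_banded lLi,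
  lower_tri_banded lLhi).
have bLhS := banded_mul bLh bS.
rewrite (upper_inverse_uniq uUh iUhat iUh).
rewrite -[Uhi]smx_mul1l -LhLhi -(smx_mulA _ bLh bLhi) -MhE.
rewrite (smx_mulA _ bLh bS) (smx_mulA _ bLhS bLi).
by rewrite -(smx_mulA_banded_upper _ (banded_mul bLhS bLi) uU) UiU smx_mul1r.
Qed.

End Recurrence.

(** * Linear relations between the families [B] and [Bhat] *)

Section Christoffel.
Context (R : realType) (q d : nat).
Variables (c : 'I_q -> R[i]) (zz : 'M[R[i]]_(q, 2 * d)).
Implicit Types L N : nat -> nat -> R[i].

Lemma balanced_laurent_root b l : balanced_laurent c zz b (zz b l) = 0.
Proof. by rewrite /balanced_laurent (bigD1 l)//= subrr mul0r mulr0. Qed.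

(** Brings the numerator to the shape of [det_bordered], with the denominator as upper left
    block. *)
Lemma numerator_mxE L n b z : numerator_mx L zz n b z =
  block_mx (denominator_mx L zz n) (\col_i Bmx L z (n + i)%N b)
    (zeros_row L zz (n + q * (2 * d))%N) (Bmx L z (n + q * (2 * d))%N b)%:M.
Proof.
rewrite -[LHS]submxK; congr block_mx; apply/matrixP => i j;
  rewrite 3![LHS]mxE /=.
- by rewrite row_mxEl mxE.
- by rewrite row_mxEr !ord1 !mxE eqxx mulr1n.
- by rewrite row_mxEl !ord1 addn0.
- by rewrite row_mxEr !ord1 addn0.
Qed.

(** [Uhat^-1 U] shows the triangular shape and the nonzero diagonal; [Lhat S L^-1] shows the band
    and the action on [B]. *)
Lemma connection_mxP (p : nat) (mu muhat : 'M[complex_measure R]_(q, p))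
    (L U Lhat Uhat Uhatinv : nat -> nat -> R[i]) :
  (0 < q)%N ->
  christoffel_perturbed (balanced_laurent c zz) mu muhat ->
  gauss_borel (moment_mx mu) L U -> gauss_borel (moment_mx muhat) Lhat Uhat ->
  upper_inverse Uhat Uhatinv ->
  let NC := smx_mul Uhatinv U in
  [/\ upper_tri NC, banded (2 * d * q) NC, forall n, NC n n != 0 &
      forall z, z != 0 -> smx_mul NC (Bmx L z) =
        fun i b => balanced_laurent c zz b z * Bmx Lhat z i b].
Proof.
move=> q0 hmuhat [lL uU _ U0 [Linv [Uinv [iL iU ME]]]] hLUhat iUhat NC.
have [S bS SZ] := laurent_shift_mx q0 c zz.
have MhE := moment_mx_perturbed hmuhat bS SZ.
have [lLh uUh _ _ _] := hLUhat.
rewrite MhE in hLUhat.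
have NCE : NC = smx_mul (smx_mul Lhat S) Linv :=
  connection_mx bS ME uU iL iU hLUhat iUhat.
have [lLi [_ LiL]] := iL; have [uUhi _] := iUhat.
have [[bL bLh] bLi] := (lower_tri_banded lL, lower_tri_banded lLh,
  lower_tri_banded lLi).
have bLhS := banded_mul bLh bS.
have bP := banded_mul bLhS bLi.
split.
- exact: upper_tri_mul.
- by rewrite NCE; move: bP; rewrite add0n addn0.
- move=> n; rewrite /NC upper_tri_mul_diag// mulf_neq0//.
  exact: upper_inverse_diag_neq0 iUhat.
(* [L^-1] cancels the [L] of [B], leaving [Lhat S Z]; the factor [W_b] depends only on the column,
   so it passes through [Lhat]. *)
move=> z z0; rewrite NCE /Bmx (smx_mulA _ bP bL) -(smx_mulA _ bLhS bLi) LiL.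
rewrite smx_mul1r -(smx_mulA _ bLh bS) SZ//.
apply/funext => i; apply/funext => b.
rewrite !(smx_mul_bandedE _ _ (K := (i + 0).+1) bLh)// mulr_sumr.
by apply: eq_bigr => k _; rewrite mulrCA.
Qed.

End Christoffel.

(** * The Christoffel formula as a quotient of determinants *)

Unset Implicit Arguments.

Theorem proposition3p3 (R : realType) (p q d : nat)
  (hp : (0 < p)%N) (hq : (0 < q)%N) (hd : (0 < d)%N)
  (mu muhat : 'M[complex_measure R]_(q, p))
  (hmu : forall (b : 'I_q) (a : 'I_p), infinite_set (cmeasure_support (mu b a)))
  (c : 'I_q -> R[i]) (zz : 'M[R[i]]_(q, 2 * d))
  (hc : forall b : 'I_q, c b != 0)
  (hzz : forall (b : 'I_q) (l : 'I_(2 * d)), zz b l != 0)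
  (hzz_inj : injective (fun bl : 'I_q * 'I_(2 * d) => zz bl.1 bl.2))
  (hmuhat : christoffel_perturbed (balanced_laurent c zz) mu muhat)
  (L U Lhat Uhat Uhatinv : nat -> nat -> R[i])
  (hLU : gauss_borel (moment_mx mu) L U)
  (hLUhat : gauss_borel (moment_mx muhat) Lhat Uhat)
  (hUhatinv : upper_inverse Uhat Uhatinv)
  (n : nat) (hden : \det (denominator_mx L zz n) != 0)
  (b : 'I_q) (z : R[i]) (hz : z != 0) (hW : balanced_laurent c zz b z != 0) :
  let NC := smx_mul Uhatinv U in
  1 / NC n (n + 2 * d * q)%N * Bmx Lhat z n b =
  1 / balanced_laurent c zz b z *
  (\det (numerator_mx L zz n b z) / \det (denominator_mx L zz n)).
Proof.
move=> NC.
have [uNC bNC NCdiag NCB] := connection_mxP hq hmuhat hLU hLUhat hUhatinv.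
rewrite -/NC in uNC bNC NCdiag NCB.
(* [mxvec] gives the matrices size [q * (2 * d)], so the band width is rewritten in that order. *)
have wE : (2 * d * q = q * (2 * d))%N by rewrite mulnC.
rewrite wE in bNC *; set K := (q * (2 * d))%N in bNC *.
set D := denominator_mx L zz n in hden *.
pose v : 'rV_K := \row_i NC n (n + i)%N.
pose a := NC n (n + K)%N; rewrite -/a.
have rowE (y : R[i]) b' : y != 0 ->
    \sum_(k < K) NC n (n + k)%N * Bmx L y (n + k)%N b' +
      a * Bmx L y (n + K)%N b' = balanced_laurent c zz b' y * Bmx Lhat y n b'.
  by move=> y0; rewrite -(smx_mul_band _ _ _ uNC bNC) (NCB _ y0).
(* Column [(b', l)] is evaluated at a zero of its own [W_b']; this point is nonzero, so [rowE]
   applies there. *)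
have vD : v *m D + a *: zeros_row L zz (n + K) = 0.
  apply/rowP => j; case/mxvec_indexP: j => b' l.
  rewrite !mxE mxvecE mxE.
  transitivity (balanced_laurent c zz b' (zz b' l) * Bmx Lhat (zz b' l) n b').
    rewrite -rowE//; congr (_ + _).
    by apply: eq_bigr => k _; rewrite !mxE mxvecE mxE.
  by rewrite balanced_laurent_root mul0r.
have vc : v *m (\col_i Bmx L z (n + i)%N b) +
    a%:M *m (Bmx L z (n + K)%N b)%:M =
    (balanced_laurent c zz b z * Bmx Lhat z n b)%:M.
  rewrite -rowE// -scalar_mxM raddfD /=; congr (_ + _).
  apply/matrixP => i j; rewrite !ord1 !mxE eqxx mulr1n.
  by apply: eq_bigr => k _; rewrite !mxE.
have a0 : a != 0.
  apply: contraNneq (NCdiag n) => a0.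
  (* Since [K > 0], [v] has an entry of index 0, namely the diagonal entry [NC n n]. *)
  have K0 : (0 < K)%N by rewrite !muln_gt0 hq hd.
  have uD : D \in unitmx by rewrite unitmxE unitfE.
  have v0 : v = 0.
    by apply/(can_inj (mulmxK uD)); rewrite mul0mx -[RHS]vD a0 scale0r addr0.
  by have /rowP/(_ (Ordinal K0)) := v0; rewrite !mxE /= addn0 => ->.
(* This gives [a] times the numerator as the denominator times [W_b(z) Bhat_n^(b)(z)]; only division
   by nonzero factors remains. *)
have detE := det_bordered vD vc; rewrite -numerator_mxE -/D in detE.
rewrite -(mulKf a0 (\det (numerator_mx L zz n b z))) detE.
by field; rewrite hden a0 hW.
Qed.
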